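(* Let $f$ be a decreasing probability mass function on the non-negative integers with finite entropy, and let $\hat f$ be its log-concave projection, i.e. a maximizer of $J(g)=\sum_x f(x)\log g(x)$ over all log-concave probability mass functions $g$. Then $\hat f$ is decreasing.
   Context: A probability mass function $g$ on the integers is log-concave if its support is a set of consecutive integers and $g(i)^2\ge g(i-1)g(i+1)$ for all $i$.
   Formalization: The maximal value J(f̂) is required to be finite: for f of infinite mean (e.g. f(x) ∝ 1/(x+1)²) every log-concave g has J(g) = −∞, so literally any of them would be a maximizer and the claim would fail; ''decreasing'' is in the weak sense. *)

(* Defs.v *)
From HB Require Import structures.
From mathcomp Require Import all_boot all_order all_algebra.
From mathcomp Require Import all_classical all_reals all_analysis.

Set Implicit Arguments.
Unset Strict Implicit.
Unset Printing Implicit Defensive.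

Import Order.TTheory GRing.Theory Num.Theory.

Local Open Scope classical_set_scope.
Local Open Scope ring_scope.

Definition is_pmf (R : realType) (g : int -> R) : Prop :=
  (forall x, 0 <= g x) /\ (\esum_(x in [set: int]) (g x)%:E = 1)%E.

Definition log_concave (R : realType) (g : int -> R) : Prop :=
  (forall i j k : int, i <= j -> j <= k -> g i != 0 -> g k != 0 -> g j != 0) /\
  (forall i : int, g (i - 1) * g (i + 1) <= g i ^+ 2).

(* "Decreasing on the non-negative integers" for a function on all integers:
   it vanishes on the negative integers and is non-increasing (in the weak
   sense) on the others. *)
Definition decreasing_nneg (R : realType) (g : int -> R) : Prop :=
  (forall x : int, x < 0 -> g x = 0) /\
  (forall x y : int, 0 <= x -> x <= y -> g y <= g x).

(* Positive part minus negative part, because [esum] is a supremum over finite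
   subsets and is the sum only for non-negative terms. *)
Definition zsum (R : realType) (u : int -> \bar R) : \bar R :=
  (\esum_(x in [set: int]) (u^\+ x) - \esum_(x in [set: int]) (u^\- x))%E.

(* In extended reals [lne 0 = -oo] and [0 * -oo = 0], so a term with f x = 0
   contributes 0, and a term with f x > 0 and g x = 0 makes the sum -oo. When f
   and g are probability mass functions all terms are non-positive. *)
Definition J (R : realType) (f g : int -> R) : \bar R :=
  zsum (fun x => (f x)%:E * lne (g x)%:E)%E.

Definition entropy (R : realType) (f : int -> R) : \bar R :=
  (- zsum (fun x => (f x)%:E * lne (f x)%:E))%E.

(* The maximum has to be a real number. If f has infinite mean then
   J f g = -oo for every log-concave g, because such a g decays at least
   exponentially; there is then no projection, although every log-concave
   probability mass function attains the supremum -oo. *)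
Definition log_concave_projection (R : realType) (f fhat : int -> R) : Prop :=
  [/\ is_pmf fhat, log_concave fhat, J f fhat \is a fin_num &
      forall g : int -> R, is_pmf g -> log_concave g -> (J f g <= J f fhat)%E].

(* Main.v *)
(* If [fhat] charged negative integers, restricting it to the non-negative ones
   and renormalizing would increase [J], because [f] lives there. Now let
   A_j be the mean of [fhat] on {0, ..., j} and k the least index with
   fhat (k + 1) <= A_k. Minimality gives A_0 < ... < A_k <= fhat k, so replacing
   [fhat] by the constant A_k on {0, ..., k} keeps it a log-concave probability
   mass function. By ln t <= t - 1 the change of [J] is at least
   - sum_(i <= k) f i (fhat i / A_k - 1), which is non-negative by Abel
   summation since [f] is decreasing and A_j <= A_k; it is strict at i = 0 when
   k > 0. Hence k = 0, that is fhat 1 <= fhat 0, and log-concavity propagates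
   this inequality. *)
Require Import Defs.
From mathcomp Require Import all_boot all_order all_algebra.
From mathcomp Require Import all_classical all_reals all_analysis.
From mathcomp Require Import lra zify.

Set Implicit Arguments.
Unset Strict Implicit.
Unset Printing Implicit Defensive.

Import Order.TTheory GRing.Theory Num.Theory.

Local Open Scope classical_set_scope.
Local Open Scope ring_scope.

(** * Weighted sums of logarithms against a mean value *)

(** Induction on [n]: the sum of the earlier [d i] is non-positive, so passing from the weight [w n]
    to the smaller [w n.+1] only raises the bound. The full sum may have any sign and keeps its own
    factor. *)
Lemma abel_sum_le (R : realDomainType) (w d : nat -> R) (n : nat) :
  (forall i, w i.+1 <= w i) ->
  (forall j, (j <= n)%N -> \sum_(i < j) d i <= 0) ->
  \sum_(i < n.+1) w i * d i <= w n * \sum_(i < n.+1) d i.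
Proof.
move=> w_decr; elim: n => [|n IH] d_le0; first by rewrite !big_ord1.
rewrite big_ord_recr /= [in leRHS]big_ord_recr /= mulrDr lerD2r.
apply: le_trans (IH _) _ => [j jn|]; first by rewrite d_le0// ltnW.
by rewrite ler_wnM2r// d_le0.
Qed.

Lemma ln_le_tangent (R : realType) (a x : R) :
  0 < a -> 0 < x -> ln x <= ln a + (x / a - 1).
Proof.
move=> a0 x0.
have xa0 : 0 < x / a by rewrite divr_gt0.
have /le_ln1Dx : -1 < x / a - 1 by lra.
by rewrite [1 + _]addrC subrK ln_div//; lra.
Qed.

Lemma ln_lt_tangent (R : realType) (a x : R) :
  0 < a -> 0 < x -> x != a -> ln x < ln a + (x / a - 1).
Proof.
move=> a0 x0 xa.
have xa0 : 0 < x / a by rewrite divr_gt0.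
have ln0 : ln (x / a) != 0.
  by rewrite ln_eq0//; apply: contra xa => /eqP/divr1_eq ->.
by have := expR_gt1Dx ln0; rewrite lnK// ln_div//; lra.
Qed.

(** Bounding each logarithm by its tangent at [A] leaves the weighted sum of [a i / A - 1]. Abel
    summation makes it non-positive, the unweighted total being 0. Strictness comes from index 0,
    where [a 0 < A] and [w 0 > 0]. *)
Lemma sum_ln_lt_mean (R : realType) (w a : nat -> R) (A : R) (n : nat) :
  (forall i, 0 <= w i) -> (forall i, w i.+1 <= w i) -> 0 < w 0%N ->
  (forall i, (i <= n)%N -> 0 < a i) -> a 0%N < A ->
  (forall j, (j <= n)%N -> \sum_(i < j) a i <= j%:R * A) ->
  \sum_(i < n.+1) a i = n.+1%:R * A ->
  \sum_(i < n.+1) w i * ln (a i) < \sum_(i < n.+1) w i * ln A.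
Proof.
move=> w_ge0 w_decr w0 a_gt0 a0A a_sum a_sumn.
have A0 : 0 < A by rewrite (lt_trans _ a0A)// a_gt0.
pose d i := a i / A - 1.
have sum_d j : \sum_(i < j) d i = (\sum_(i < j) a i) / A - j%:R.
  by rewrite sumrB -mulr_suml sumr_const card_ord.
have wd : \sum_(i < n.+1) w i * d i <= 0.
  apply: le_trans (abel_sum_le w_decr _) _ => [j jn|].
    by rewrite sum_d subr_le0 ler_pdivrMr// a_sum.
  by rewrite sum_d a_sumn mulfK ?gt_eqF// subrr mulr0.
apply: (@lt_le_trans _ _ (\sum_(i < n.+1) w i * (ln A + d i))); last first.
  under eq_bigr do rewrite mulrDr.
  by rewrite big_split/= gerDl.
rewrite !big_ord_recl; apply: ltr_leD.
  by rewrite ltr_pM2l// ln_lt_tangent ?a_gt0// lt_eqF.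
apply: ler_sum => i _; apply: ler_wpM2l => //.
by rewrite ln_le_tangent// a_gt0//= /bump/= add1n ltn_ord.
Qed.

(** Otherwise every later term exceeds the mean of its predecessors, hence [a 0], and the partial
    sums grow linearly past [M]. *)
Lemma exists_mean_ge_next (R : realType) (a : nat -> R) (M : R) :
  0 < a 0%N -> (forall n, \sum_(i < n) a i <= M) ->
  exists n, n.+1%:R * a n.+1 <= \sum_(i < n.+1) a i.
Proof.
move=> a0 aM; apply: contrapT => /forallNP a_big.
have a_gt n : \sum_(i < n.+1) a i < n.+1%:R * a n.+1.
  by rewrite ltNge; apply/negP/a_big.
have a_lin n : n.+1%:R * a 0%N <= \sum_(i < n.+1) a i.
  elim: n => [|n IH]; first by rewrite big_ord1 mul1r.
  rewrite big_ord_recr/= -natr1 mulrDl mul1r lerD//.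
  by have := le_lt_trans IH (a_gt n); rewrite ltr_pM2l// => /ltW.
have M0 : 0 <= M by have := aM 0%N; rewrite big_ord0.
have := archi_boundP (divr_ge0 M0 (ltW a0)).
set N := Num.bound _; rewrite ltr_pdivrMr// => MN.
have := le_lt_trans (le_trans (a_lin N) (aM _)) MN.
by rewrite ltr_pM2r// ltr_nat ltnNge leqnSn.
Qed.

(** * Sums over the integers and comparison of series *)

Lemma esum_intE (R : realType) (h : int -> \bar R) :
  (forall x, (0 <= h x)%E) -> (forall x, x < 0 -> h x = 0%E) ->
  (\esum_(x in [set: int]) h x = \sum_(i <oo) h i%:Z)%E.
Proof.
move=> h_ge0 h_neg; rewrite (esumID (range Posz))// setTI.
rewrite esum_image; last by move=> i j _ _ [].
rewrite -nneseries_esumT// esum1 ?adde0//.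
by move=> [n|n] [_ /=] nn; [case: nn; exists n|rewrite h_neg].
Qed.

(** The tails are compared termwise; finiteness of the larger sum keeps the strict gain in the head
    from being absorbed by an infinite tail. *)
Lemma lt_nneseries (R : realType) (a b : nat -> \bar R) (n : nat) :
  (forall i, 0 <= a i)%E -> (forall i, 0 <= b i)%E ->
  (forall i, (n <= i)%N -> (a i <= b i)%E) ->
  (\sum_(i < n) a i < \sum_(i < n) b i)%E ->
  (\sum_(i <oo) b i < +oo)%E ->
  (\sum_(i <oo) a i < \sum_(i <oo) b i)%E.
Proof.
move=> a0 b0 ab ab_lt.
rewrite !(nneseries_split 0 n)// !add0n !big_mkord => b_fin.
have tail : (\sum_(n <= i <oo) a i <= \sum_(n <= i <oo) b i)%E.
  by rewrite !(eseries_cond _ predT) lee_nneseries// => i /= ni; exact: ab.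
apply: lte_leD => //.
rewrite ge0_fin_numE ?nneseries_ge0//; apply: le_lt_trans b_fin.
by rewrite (le_trans tail)// leeDr// sume_ge0.
Qed.

(** * The functional [J] as a series *)

Lemma pmf_le1 (R : realType) (g : int -> R) x : is_pmf g -> g x <= 1.
Proof.
move=> [g0 g1]; rewrite -lee_fin -g1 (esumID [set x]); last first.
  by move=> i _; rewrite lee_fin.
rewrite setTI esum_set1 ?lee_fin// leeDl// esum_ge0// => i _.
by rewrite lee_fin.
Qed.

Lemma cross_term_ge0 (R : realType) (f g : int -> R) x :
  is_pmf f -> is_pmf g -> (0 <= (f x)%:E * - lne (g x)%:E)%E.
Proof.
move=> [f0 _] g_pmf; rewrite mule_ge0 ?lee_fin// oppe_ge0 lne_le0 lee_fin.
exact: pmf_le1.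
Qed.

(** Values of [g] are at most 1, so no logarithm is positive and only the negative part of the sum
    survives. *)
Lemma JE (R : realType) (f g : int -> R) :
  is_pmf f -> (forall x, x < 0 -> f x = 0) -> is_pmf g ->
  (J f g = - \sum_(i <oo) (f i%:Z)%:E * - lne (g i%:Z)%:E)%E.
Proof.
move=> f_pmf f_neg g_pmf; rewrite /J /zsum.
have t0 x := cross_term_ge0 x f_pmf g_pmf.
rewrite esum1 ?add0e => [|x _]; last first.
  by rewrite funeposE; apply/max_idPr; rewrite -oppe_ge0 -muleN.
congr (- _)%E.
rewrite -(esum_intE (h := fun x => ((f x)%:E * - lne (g x)%:E)%E))//; last first.
  by move=> x /f_neg ->; rewrite mul0e.
apply: eq_esum => x _; rewrite funenegE -muleN; exact/max_idPl.
Qed.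

(** A zero of [g] where [f] is positive would put a term [+oo] into the series for [- J f g]. *)
Lemma J_fin_num_gt0 (R : realType) (f g : int -> R) (n : nat) :
  is_pmf f -> (forall x, x < 0 -> f x = 0) -> is_pmf g ->
  J f g \is a fin_num -> 0 < f n%:Z -> 0 < g n%:Z.
Proof.
move=> f_pmf f_neg g_pmf; rewrite JE// fin_numN => fin fn.
have [g0 _] := g_pmf; rewrite lt0r g0 andbT; apply/eqP => gn.
move: fin; rewrite (@nneseries_pinfty _ _ _ n)//.
  by move=> i _; exact: cross_term_ge0.
by rewrite gn le0_lneNy// gt0_muley.
Qed.

(** The head is compared through real logarithms, hence the positivity there; the tail through
    monotonicity of [lne], which tolerates zeros. *)
Lemma lt_J (R : realType) (f g h : int -> R) (n : nat) :
  is_pmf f -> (forall x, x < 0 -> f x = 0) -> is_pmf g -> is_pmf h ->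
  J f g \is a fin_num ->
  (forall i, (i < n)%N -> 0 < g i%:Z) -> (forall i, (i < n)%N -> 0 < h i%:Z) ->
  (forall i, (n <= i)%N -> g i%:Z <= h i%:Z) ->
  \sum_(i < n) f i%:Z * ln (g i%:Z) < \sum_(i < n) f i%:Z * ln (h i%:Z) ->
  (J f g < J f h)%E.
Proof.
move=> f_pmf f_neg g_pmf h_pmf; rewrite !JE// fin_numN => fin g0 h0 gh lt_gh.
rewrite lteN2; apply: (@lt_nneseries _ _ _ n).
- by move=> i; exact: cross_term_ge0.
- by move=> i; exact: cross_term_ge0.
- move=> i ni; rewrite lee_wpmul2l ?lee_fin ?f_pmf.1// leeN2.
  by rewrite lee_lne ?lee_fin ?gh// in_itv/= leey lee_fin andbT ?g_pmf.1 ?h_pmf.1.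
- under eq_bigr do rewrite lne_EFin ?h0// -EFinN -EFinM mulrN.
  under [ltRHS]eq_bigr do rewrite lne_EFin ?g0// -EFinN -EFinM mulrN.
  by rewrite !sumEFin lte_fin !sumrN ltrN2.
- by rewrite -ge0_fin_numE// nneseries_ge0// => i _ _; exact: cross_term_ge0.
Qed.

(** The form in which maximality is used: a competitor may change [fhat] on a finite head but only
    raise it beyond. *)
Lemma projection_not_improved (R : realType) (f fhat h : int -> R) (n : nat) :
  is_pmf f -> (forall x, x < 0 -> f x = 0) ->
  log_concave_projection f fhat -> is_pmf h -> log_concave h ->
  (forall i, (i < n)%N -> 0 < fhat i%:Z) ->
  (forall i, (i < n)%N -> 0 < h i%:Z) ->
  (forall i, (n <= i)%N -> fhat i%:Z <= h i%:Z) ->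
  ~ \sum_(i < n) f i%:Z * ln (fhat i%:Z) < \sum_(i < n) f i%:Z * ln (h i%:Z).
Proof.
move=> f_pmf f_neg [g_pmf _ g_fin g_max] h_pmf h_lc g0 h0 gh lt_gh.
by have := lt_J f_pmf f_neg g_pmf h_pmf g_fin g0 h0 gh lt_gh; rewrite ltNge g_max.
Qed.

(** * No mass on the negative integers *)

Lemma projection_neg_eq0 (R : realType) (f fhat : int -> R) :
  is_pmf f -> (forall x, x < 0 -> f x = 0) -> 0 < f 0 ->
  log_concave_projection f fhat -> forall y, y < 0 -> fhat y = 0.
Proof.
move=> f_pmf f_neg f0 proj y y0; apply/eqP/negPn/negP => gy.
have [g_pmf [g_supp g_lc] g_fin _] := proj; have [g_ge0 g_sum] := g_pmf.
have g0 : 0 < fhat 0 by exact: (J_fin_num_gt0 f_pmf f_neg g_pmf g_fin f0).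
pose t (x : int) := if x < 0 then 0 else fhat x.
have t_ge0 x : 0 <= t x by rewrite /t; case: ifP.
pose M := (\esum_(x in [set: int]) (t x)%:E)%E.
(* Truncation loses the point [y], so the remaining mass [M] misses 1 by at least [fhat y]. *)
have MD : (M + (fhat y)%:E <= 1)%E.
  have tE : (M = \esum_(x in ~` [set y]) (t x)%:E)%E.
    rewrite /M [LHS](esumID [set y]) => [|i _]; last by rewrite lee_fin.
    by rewrite !setTI esum_set1 ?lee_fin// {1}/t y0 add0e.
  rewrite tE -g_sum [leRHS](esumID [set y]) => [|i _]; last by rewrite lee_fin.
  rewrite !setTI esum_set1 ?lee_fin// [leRHS]addeC leeD2r//.
  by apply: le_esum => x _; rewrite lee_fin /t; case: ifP.
have ME : (M = \sum_(i <oo) (t i%:Z)%:E)%E.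
  rewrite /M (esum_intE (h := fun x => (t x)%:E))// => x x0.
  by rewrite /t x0.
have M0 : (0 < M)%E.
  rewrite ME; apply: lt_le_trans (nneseries_lim_ge 1 _) => [|i _ _].
    by rewrite big_nat1 lte_fin /t ltxx.
  by rewrite lee_fin.
have M_fin : M \is a fin_num.
  rewrite ge0_fin_numE ?(ltW M0)//; apply: le_lt_trans (ltry 1).
  by apply: le_trans MD; rewrite leeDl// lee_fin.
have M1 : (M < 1)%E.
  by apply: lt_le_trans MD; rewrite lteDl// lte_fin lt0r gy g_ge0.
pose m := fine M.
have mE : M = m%:E by rewrite fineK.
have m0 : 0 < m by rewrite -lte_fin -mE.
have m1 : m < 1 by rewrite -lte_fin -mE.
pose h (x : int) := m^-1 * t x.
have h_ge0 x : 0 <= h x by rewrite mulr_ge0// invr_ge0 ltW.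
have m'1 : 1 < m^-1 by rewrite invf_gt1.
have h_pmf : is_pmf h.
  split=> //; rewrite (esum_intE (h := fun x => (h x)%:E))//; last first.
    by move=> x x0; rewrite /h /t x0 mulr0.
  under eq_eseriesr do rewrite EFinM.
  rewrite nneseriesZl => [|i _]; last by rewrite lee_fin.
  by rewrite -ME mE -EFinM mulVf// gt_eqF.
have m'_neq0 : m^-1 != 0 by rewrite invr_eq0 gt_eqF.
have h_lc : log_concave h.
  split=> [i j k ij jk|i].
    rewrite /h !mulf_eq0 !negb_or !m'_neq0 /t /=.
    case: (ltP i 0) => [|i0]; first by rewrite eqxx.
    have [-> ->] : (j < 0) = false /\ (k < 0) = false by lia.
    exact: g_supp.
  rewrite /h exprMn mulrACA -expr2 ler_wpM2l ?sqr_ge0// /t.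
  (* If [i - 1] is cut off, the product is 0; otherwise none of the three points is cut off. *)
  case: (ltP (i - 1)) => [|i0]; first by rewrite mul0r sqr_ge0.
  have -> : (i < 0) = false by lia.
  by have -> : (i + 1 < 0) = false by lia.
(* The head is the single index 0, where [f 0 > 0] and the factor [m^-1 > 1] give the strict
   gain. *)
apply: (@projection_not_improved _ f fhat h 1) => //.
- by case.
- by case=> // _; rewrite /h mulr_gt0 ?invr_gt0// /t ltxx.
- by move=> i _; rewrite /h /t/= ler_peMl// ltW.
- rewrite !big_ord1/= ltr_pM2l// /h /t ltxx ltr_ln// ?posrE ?mulr_gt0 ?invr_gt0//.
  by rewrite ltr_pMl.
Qed.

(** * Monotonicity of the projection *)

(** Where [g n.+1 > 0], the induction hypothesis gives [g n.+1 * g n.+2 <= g n * g n.+2 <= g n.+1 ^+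
    2], and one factor cancels. Where [g n.+1 = 0], a support without gaps containing 0 has
    ended. *)
Lemma log_concave_nonincreasing (R : realType) (g : int -> R) :
  (forall x, 0 <= g x) -> log_concave g -> 0 < g 0 -> g 1 <= g 0 ->
  forall n : nat, g n.+1%:Z <= g n%:Z.
Proof.
move=> g_ge0 [g_supp g_lc] g0 g10; elim=> [//|n IH].
have [gn|gn] := eqVneq (g n.+1%:Z) 0.
  rewrite gn le_eqVlt; apply/orP; left; apply/negPn/negP => gn2.
  have := g_supp 0 n.+1%:Z n.+2%:Z; rewrite gn eqxx gt_eqF//= gn2 => H.
  by have /H := le0z_nat n.+1; rewrite lez_nat leqnSn => /(_ isT isT isT).
have gn0 : 0 < g n.+1%:Z by rewrite lt0r gn g_ge0.
rewrite -(ler_pM2l gn0) -expr2.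
apply: le_trans (g_lc n.+1%:Z).
have -> : n.+1%:Z - 1 = n%:Z by lia.
have -> : n.+1%:Z + 1 = n.+2%:Z by lia.
by rewrite ler_wpM2r.
Qed.

Lemma projection_head_ge (R : realType) (f fhat : int -> R) :
  is_pmf f -> decreasing_nneg f -> 0 < f 0 ->
  log_concave_projection f fhat -> fhat 1 <= fhat 0.
Proof.
move=> f_pmf [f_neg f_decr] f0 proj.
have g_neg := projection_neg_eq0 f_pmf f_neg f0 proj.
have [g_pmf [g_supp g_lc] g_fin _] := proj; have [g_ge0 g_sum] := g_pmf.
have g0 : 0 < fhat 0 by exact: (J_fin_num_gt0 f_pmf f_neg g_pmf g_fin f0).
have gE_ge0 x : (0 <= (fhat x)%:E)%E by rewrite lee_fin.
have g_ser : (\sum_(i <oo) (fhat i%:Z)%:E = 1)%E.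
  rewrite -g_sum (esum_intE (h := fun x => (fhat x)%:E))// => x x0.
  by rewrite g_neg.
pose a (i : nat) := fhat i%:Z.
have a_sum n : \sum_(i < n) a i <= 1.
  rewrite -lee_fin -g_ser -sumEFin -(big_mkord predT (fun i => (a i)%:E)).
  by apply: nneseries_lim_ge => i _ _; exact: gE_ge0.
have ex_k := exists_mean_ge_next g0 a_sum.
have [k k_ge k_min] := ex_minnP ex_k.
have a_gt j : (j < k)%N -> \sum_(i < j.+1) a i < j.+1%:R * a j.+1.
  by move=> jk; rewrite ltNge; apply/negP => /k_min; rewrite leqNgt jk.
(* Least index 0 is the claim itself. Afterwards the least index is [k.+1], and the block to be
   flattened has [k.+2] points. *)
case: k => [|k] in k_ge k_min a_gt *.
  by move: k_ge; rewrite mul1r big_ord1.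
exfalso.
pose mean j := (\sum_(i < j.+1) a i) / j.+1%:R.
have meanE j : \sum_(i < j.+1) a i = j.+1%:R * mean j.
  by rewrite /mean mulrC divfK// pnatr_eq0.
have mean_gt j : (j < k.+1)%N -> mean j < a j.+1.
  by move=> /a_gt; rewrite meanE ltr_pM2l.
(* The new mean is a weighted average of [mean j] and the larger [a j.+1]. *)
have mean_lt j : (j < k.+1)%N -> mean j < mean j.+1 < a j.+1.
  move=> jk; have := mean_gt _ jk; have := meanE j.+1.
  rewrite big_ord_recr/= meanE => e lt.
  have j0 : 0 < j.+1%:R :> R by [].
  have e2 : j.+2%:R = j.+1%:R + 1 :> R by rewrite natr1.
  by rewrite e2 in e; apply/andP; split; nra.
have mean_mono i j : (i <= j <= k.+1)%N -> mean i <= mean j.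
  move=> /andP[]; elim: j => [|j IH]; first by rewrite leqn0 => /eqP ->.
  rewrite leq_eqVlt => /predU1P[->//|]; rewrite ltnS => ij jk.
  by rewrite (le_trans (IH ij (ltnW jk)))//; have /andP[/ltW] := mean_lt _ jk.
have mean0 : mean 0%N = a 0%N by rewrite /mean big_ord1 divr1.
set A := mean k.+1.
have a0A : a 0%N < A.
  rewrite -mean0; have /andP[mean01 _] := mean_lt 0%N isT.
  by rewrite (lt_le_trans mean01)// mean_mono/= ?leqnn.
have A0 : 0 < A := lt_trans g0 a0A.
(* These two bounds place [A] between the last value of the block and the value after it; they
   secure log-concavity at the right edge. *)
have Aak : A <= a k.+1 by have /andP[_ /ltW] := mean_lt k (ltnSn k).
have akA : a k.+2 <= A by move: k_ge; rewrite meanE ler_pM2l.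
have a_gt0 i : (i < k.+2)%N -> 0 < a i.
  case: i => [//|i]; rewrite ltnS => ik; apply: le_lt_trans (mean_gt _ ik).
  by rewrite (le_trans (ltW g0))// -/(a 0%N) -mean0 mean_mono// leq0n ltnW.
pose h (x : int) := if (0 <= x) && (x <= k.+1%:Z) then A else fhat x.
have hE i : h i%:Z = if (i < k.+2)%N then A else a i by [].
have h_ge0 x : 0 <= h x by rewrite /h; case: ifP => // _; exact: ltW.
have h_neg x : x < 0 -> h x = 0 by move=> x0; rewrite /h leNgt x0 g_neg.
have h_pmf : is_pmf h.
  split=> //; rewrite (esum_intE (h := fun x => (h x)%:E))//; last first.
    by move=> x /h_neg ->.
  rewrite -g_ser !(nneseries_split 0 k.+2)//; last by move=> i _; rewrite lee_fin.
  rewrite !add0n; congr (_ + _)%E.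
    rewrite !big_mkord !sumEFin meanE; congr EFin.
    under eq_bigr do rewrite hE ltn_ord.
    by rewrite sumr_const card_ord mulr_natl.
  rewrite eseries_cond [RHS]eseries_cond.
  by apply: eq_eseriesr => i /= ki; rewrite hE ltnNge ki.
have h_lc : log_concave h.
  split=> [i j l ij jl|i].
    rewrite /h; case: (boolP (0 <= j <= k.+1%:Z)) => [_ _ _|].
      by rewrite gt_eqF.
    rewrite negb_and -!ltNge => /orP[j0|kj].
      have i0 : i < 0 by lia.
      by rewrite leNgt i0/= g_neg// eqxx.
    have -> : (l <= k.+1%:Z) = false by lia.
    (* For [i] in the block, 0 serves as the left end, since [fhat 0 > 0]. *)
    rewrite andbF; case: ifP => [_ _|_]; last exact: g_supp.
    by apply: (g_supp 0) => //; [lia|rewrite gt_eqF].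
  have [i0|i0] := ltP (i - 1) 0; first by rewrite h_neg// mul0r sqr_ge0.
  have [n ni] : exists n : nat, i = n.+1%:Z by exists `|i|.-1%N; lia.
  have -> : i - 1 = n%:Z by lia.
  have -> : i + 1 = n.+2%:Z by lia.
  have := g_lc i; have -> : i - 1 = n%:Z by lia.
  have -> : i + 1 = n.+2%:Z by lia.
  rewrite ni !hE -/(a n) -/(a n.+1) -/(a n.+2) => lc.
  have [nk|nk|nk] := ltngtP n k.+1.
  (* The left and middle values are [A]; the right one is [A] or, at the edge, [a k.+2 <= A]. *)
  - have [-> ->] : (n < k.+2)%N /\ (n.+1 < k.+2)%N by lia.
    case: ltnP => kn; first by rewrite expr2.
    have -> : n = k by lia.
    by rewrite expr2 ler_wpM2l// ltW.
  - have [-> [-> ->]] : (n < k.+2)%N = false /\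
      ((n.+1 < k.+2)%N = false /\ (n.+2 < k.+2)%N = false) by lia.
    exact: lc.
  (* Only the left value is changed, from [a k.+1] down to [A], which lowers the product. *)
  - have [-> [-> ->]] : (n < k.+2)%N = true /\
      ((n.+1 < k.+2)%N = false /\ (n.+2 < k.+2)%N = false) by lia.
    by apply: le_trans lc; rewrite nk ler_wpM2r// /a.
apply: (@projection_not_improved _ f fhat h k.+2) => //.
- by move=> i ik; rewrite hE ik.
- by move=> i ik; rewrite hE ltnNge ik.
under [ltRHS]eq_bigr do rewrite hE ltn_ord.
apply: (@sum_ln_lt_mean _ (fun i => f i%:Z) a) => //.
- by move=> i; exact: f_pmf.1.
- by move=> i; apply: f_decr; lia.
- case=> [|j] jk; first by rewrite big_ord0 mul0r.
  by rewrite meanE ler_wpM2l// mean_mono// leqnn andbT; lia.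
Qed.

Theorem theorem6p2 (R : realType) (f fhat : int -> R)
  (f_pmf : is_pmf f)
  (f_decreasing : decreasing_nneg f)
  (f_entropy : entropy f \is a fin_num)
  (fhat_projection : log_concave_projection f fhat) :
  decreasing_nneg fhat.
Proof.
have [f_neg f_decr] := f_decreasing.
have f0 : 0 < f 0.
  (* [f 0] is the largest value of [f], so if it were 0 the total mass would be 0. *)
  rewrite lt0r f_pmf.1 andbT; apply/eqP => f00.
  have := f_pmf.2; rewrite esum1; first by move=> /eqP; rewrite eqe eq_sym oner_eq0.
  move=> x _; have [/f_neg->//|x0] := ltP x 0.
  by congr EFin; apply/eqP; rewrite eq_le f_pmf.1 andbT -f00 f_decr.
split; first exact: projection_neg_eq0 fhat_projection.
have [g_pmf g_lc g_fin _] := fhat_projection.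
have g0 : 0 < fhat 0 by exact: (J_fin_num_gt0 f_pmf f_neg g_pmf g_fin f0).
have g10 := projection_head_ge f_pmf f_decreasing f0 fhat_projection.
have g_decr := log_concave_nonincreasing g_pmf.1 g_lc g0 g10.
case=> [m|//] [n|//] _; rewrite lez_nat => mn.
exact: ((nonincreasing_seqP (fun i : nat => fhat i%:Z)).1 g_decr).
Qed.
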